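(* Let $\mathbf k=(k_1,\dots,k_q)$ be a rank profile and suppose that, if $\mathcal M_{\mathbf k}\ne\varnothing$, there is an open neighborhood $\mathcal U_{\mathbf k}\supset\mathcal M_{\mathbf k}$ on which $F\mapsto Dc(F)$ has constant rank. For any $y\in\mathbb R^m$ and $\rho>0$, every feasible full-space second-order stationary point $F$ of $\Phi_{\rho,y}$ (that is, $c(F)=0$, $\nabla\Phi_{\rho,y}(F)=0$ and $\nabla^2\Phi_{\rho,y}(F)\succeq0$ on the whole factor space) satisfies $$S_{B,c}(F)F_c=0\quad(c\in[q]),\qquad \sum_{c=1}^q\langle U_c,S_{B,c}(F)U_c\rangle\ge0\quad\text{for every }U\in\ker Dc(F).$$
   Context: Let $q,m,n_1,\dots,n_q,k_1,\dots,k_q$ be positive integers, $[q]=\{1,\dots,q\}$, $\mathbb S^n$ the real symmetric $n\times n$ matrices. Fix $b\in\mathbb R^m$, $C_c\in\mathbb S^{n_c}$ and linear maps $\mathcal A_c:\mathbb S^{n_c}\to\mathbb R^m$ with adjoints $\mathcal A_c^*$ (redundant affine rows are allowed). Factors: $F=(F_c)_c$, $F_c\in\mathbb R^{n_c\times k_c}$, with direct-sum inner product $\sum_c\langle F_c,U_c\rangle$. Set $g(F):=\sum_c\langle C_c,F_cF_c^\top\rangle$, $c(F):=\sum_c\mathcal A_c(F_cF_c^\top)-b$, $\mathcal M_{\mathbf k}:=\{F:c(F)=0\}$, $Dc(F)[U]=\sum_c\mathcal A_c(F_cU_c^\top+U_cF_c^\top)$, and $\Phi_{\rho,y}(F):=g(F)-\langle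 y,c(F)\rangle+\frac\rho2\|c(F)\|_2^2$. Let $\mathcal B_F\nu:=(\mathcal A_c^*(\nu)F_c)_{c}$ for $\nu\in\mathbb R^m$, $G(F):=\mathcal B_F^*\mathcal B_F$, $C_F:=(C_cF_c)_{c}$, $\mu_B(F):=G(F)^\dagger\mathcal B_F^*C_F$ (Moore--Penrose pseudoinverse), and $S_{B,c}(F):=C_c-\mathcal A_c^*(\mu_B(F))$. *)

(* Defs.v *)
From HB Require Import structures.
From mathcomp Require Import all_boot all_order all_algebra.
From mathcomp Require Import all_classical all_reals all_analysis.

Set Implicit Arguments.
Unset Strict Implicit.
Unset Printing Implicit Defensive.

Import Order.TTheory GRing.Theory Num.Theory.
Import numFieldNormedType.Exports.

Local Open Scope classical_set_scope.
Local Open Scope ring_scope.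

Definition sym_pred {R : realType} {n : nat} : {pred 'M[R]_n} :=
  fun A => A \is symmetricmx.

Lemma sym_predE (R : realType) n (A : 'M[R]_n) : (A \in sym_pred) = (A^T == A).
Proof.
by rewrite unfold_in /sym_pred qualifE /= expr0 scale1r map_mx_id // eq_sym.
Qed.

Lemma sym_pred_submod_closed (R : realType) n :
  submod_closed (@sym_pred R n).
Proof.
split=> [|a A B]; rewrite !sym_predE ?trmx0 //.
by move=> /eqP hA /eqP hB; rewrite linearD linearZ /= hA hB.
Qed.

HB.instance Definition _ (R : realType) n :=
  GRing.isSubmodClosed.Build R 'M[R]_n sym_pred (@sym_pred_submod_closed R n).

Record sym (R : realType) (n : nat) :=
  Sym { symval :> 'M[R]_n; _ : symval \in sym_pred }.

HB.instance Definition _ (R : realType) n := [isSub for @symval R n].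
HB.instance Definition _ (R : realType) n := [Choice of sym R n by <:].
HB.instance Definition _ (R : realType) n :=
  [SubChoice_isSubZmodule of sym R n by <:].
HB.instance Definition _ (R : realType) n :=
  [SubZmodule_isSubLmodule of sym R n by <:].

Lemma sym_gram_subproof (R : realType) n k (F : 'M[R]_(n, k)) :
  F *m F^T \in sym_pred.
Proof. by rewrite sym_predE trmx_mul trmxK. Qed.

Definition sym_gram (R : realType) n k (F : 'M[R]_(n, k)) : sym R n :=
  Sym (sym_gram_subproof F).

Lemma sym_cross_subproof (R : realType) n k (F U : 'M[R]_(n, k)) :
  F *m U^T + U *m F^T \in sym_pred.
Proof. by rewrite sym_predE linearD /= !trmx_mul !trmxK addrC. Qed.

Definition sym_cross (R : realType) n k (F U : 'M[R]_(n, k)) : sym R n :=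
  Sym (sym_cross_subproof F U).

Definition inner (R : realType) n k (A B : 'M[R]_(n, k)) : R := \tr (A^T *m B).

(* Adjoint of a linear map [f] between inner product spaces: [adjoint f w] is
   the element [v] representing [x |-> <w, f x>].  It exists for the two maps
   used below (lemmas [AadjP] and [BadjP]). *)
Definition adjoint (R : realType) (V W : lmodType R) (ipV : V -> V -> R)
    (ipW : W -> W -> R) (f : V -> W) (w : W) : V :=
  xget 0 [set v | forall x, ipV v x = ipW w (f x)].

Definition is_pinv (R : realType) m n (A : 'M[R]_(m, n)) (X : 'M[R]_(n, m)) :=
  [/\ A *m X *m A = A, X *m A *m X = X,
      (A *m X)^T = A *m X & (X *m A)^T = X *m A].

(* Moore--Penrose pseudoinverse: [is_pinv A] lists the Penrose equations, whose
   unique solution is [pinv A] (lemmas [pinvP] and [is_pinv_unique]). *)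
Definition pinv (R : realType) m n (A : 'M[R]_(m, n)) : 'M[R]_(n, m) :=
  xget 0 [set X | is_pinv A X].

Definition gradient (R : realType) N (f : 'rV[R]_N -> R) (x : 'rV[R]_N) :
    'rV[R]_N :=
  \row_j 'D_(delta_mx 0 j) f x.

Definition hessian (R : realType) N (f : 'rV[R]_N -> R) (x : 'rV[R]_N) :
    'M[R]_N :=
  jacobian (gradient f) x.

(* The factor space, i.e. the direct sum of the spaces R^(n_c x k_c), flattened
   to row vectors so as to carry the library's topology and normed structure;
   [fac F c] is the block F_c and [mkfac] assembles the blocks. *)
Definition factors (R : realType) q (n k : 'I_q -> nat) :=
  'rV[R]_(\sum_c (n c * k c)%N).

Section Factors.
Context {R : realType} {q : nat} {n k : 'I_q -> nat}.
Implicit Types F U : factors R n k.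

Definition fac F (c : 'I_q) : 'M[R]_(n c, k c) := vec_mx (submxrow F c).

Definition mkfac (M : forall c, 'M[R]_(n c, k c)) : factors R n k :=
  \mxrow_c mxvec (M c).

Definition finner F U : R := \sum_c inner (fac F c) (fac U c).

End Factors.

Section Problem.
Context {R : realType} {q m : nat} {n k : 'I_q -> nat}.
Variables (C : forall c, sym R (n c)).
Variables (A : forall c, {linear sym R (n c) -> 'rV[R]_m}) (b : 'rV[R]_m).
Implicit Types F U : factors R n k.

Definition Aadj c : 'rV[R]_m -> sym R (n c) :=
  adjoint (fun X Y : sym R (n c) => inner X Y) (@inner R 1 m) (A c).

Definition objective F : R := \sum_c inner (C c) (sym_gram (fac F c)).

Definition constr F : 'rV[R]_m := \sum_c A c (sym_gram (fac F c)) - b.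

Definition feasible : set (factors R n k) := [set F | constr F = 0].

Definition Dconstr F U : 'rV[R]_m := \sum_c A c (sym_cross (fac F c) (fac U c)).

Definition auglag (rho : R) (y : 'rV[R]_m) F : R :=
  objective F - inner y (constr F) + rho / 2 * inner (constr F) (constr F).

Definition Bmap F (nu : 'rV[R]_m) : factors R n k :=
  mkfac (fun c => Aadj c nu *m fac F c).

Definition Badj F : factors R n k -> 'rV[R]_m :=
  adjoint (@inner R 1 m) finner (Bmap F).

(* Row-vector convention: a linear map [f] acts as [v |-> v *m lin1_mx f]. *)
Definition Gram F : 'M[R]_m := lin1_mx (Badj F \o Bmap F).

Definition CF F : factors R n k := mkfac (fun c => C c *m fac F c).

Definition muB F : 'rV[R]_m := Badj F (CF F) *m pinv (Gram F).

Definition SB F c : sym R (n c) := C c - Aadj c (muB F).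

Definition feasible_sosp (rho : R) (y : 'rV[R]_m) F :=
  [/\ constr F = 0, gradient (auglag rho y) F = 0 &
      forall U, 0 <= finner U (U *m hessian (auglag rho y) F)].

End Problem.

Section InnerTheory.
Context {R : realType}.

Lemma innerE n k (X Y : 'M[R]_(n, k)) : inner X Y = \sum_i \sum_j X i j * Y i j.
Proof.
rewrite /inner /mxtrace exchange_big /=; apply: eq_bigr => j _.
by rewrite mxE; apply: eq_bigr => i _; rewrite mxE.
Qed.

Lemma innerC n k (X Y : 'M[R]_(n, k)) : inner X Y = inner Y X.
Proof.
by rewrite !innerE; apply: eq_bigr => i _; apply: eq_bigr => j _; rewrite mulrC.
Qed.

Lemma innerDr n k (X Y Z : 'M[R]_(n, k)) :
  inner X (Y + Z) = inner X Y + inner X Z.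
Proof. by rewrite /inner mulmxDr linearD. Qed.

Lemma innerZr n k a (X Y : 'M[R]_(n, k)) : inner X (a *: Y) = a * inner X Y.
Proof. by rewrite /inner -scalemxAr linearZ. Qed.

Lemma innerBl n k (X Y Z : 'M[R]_(n, k)) :
  inner (X - Y) Z = inner X Z - inner Y Z.
Proof. by rewrite /inner linearB mulmxBl linearB. Qed.

Lemma inner0r n k (X : 'M[R]_(n, k)) : inner X 0 = 0.
Proof. by rewrite /inner mulmx0 linear0. Qed.

Lemma inner_sumr (I : finType) n k (X : 'M[R]_(n, k)) (Y : I -> 'M[R]_(n, k)) :
  inner X (\sum_i Y i) = \sum_i inner X (Y i).
Proof. by rewrite /inner mulmx_sumr linear_sum. Qed.

Lemma inner_ge0 n k (X : 'M[R]_(n, k)) : 0 <= inner X X.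
Proof.
by rewrite innerE; do 2!(apply: sumr_ge0 => ? _); rewrite -expr2 sqr_ge0.
Qed.

Lemma inner_eq0 n k (X : 'M[R]_(n, k)) : inner X X = 0 -> X = 0.
Proof.
rewrite innerE => /eqP; rewrite psumr_eq0; last first.
  by move=> i _; apply: sumr_ge0 => j _; rewrite -expr2 sqr_ge0.
move=> /allP h; apply/matrixP => i j; rewrite mxE.
have := h i (mem_index_enum _); rewrite psumr_eq0; last first.
  by move=> ? _; rewrite -expr2 sqr_ge0.
by move=> /allP /(_ j (mem_index_enum _)) /=; rewrite -expr2 sqrf_eq0 => /eqP.
Qed.

Lemma inner_rV m (u v : 'rV[R]_m) : inner u v = \sum_j u 0 j * v 0 j.
Proof. by rewrite innerE big_ord1. Qed.

End InnerTheory.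

Section PinvTheory.
Context {R : realType}.

Lemma is_pinv_unique m n (A : 'M[R]_(m, n)) X Y :
  is_pinv A X -> is_pinv A Y -> X = Y.
Proof.
move=> [x1 x2 x3 x4] [y1 y2 y3 y4].
have e1 : A *m X = A *m Y.
  by rewrite -x3 -{1}y1 -[A *m Y *m A *m X]mulmxA trmx_mul x3 y3 mulmxA x1.
have e2 : X *m A = Y *m A.
  by rewrite -x4 -{1}y1 -mulmxA mulmxA trmx_mul x4 y4 -mulmxA [A *m _]mulmxA x1.
by rewrite -x2 e2 -mulmxA e1 mulmxA y2.
Qed.

Lemma row_free_gram_unit r n (B : 'M[R]_(r, n)) :
  row_free B -> B *m B^T \in unitmx.
Proof.
move=> fB; rewrite -row_free_unit -kermx_eq0; apply/eqP/row_matrixP => i.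
rewrite row0; set u := row i _.
have uB0 : u *m (B *m B^T) = 0.
  by apply/sub_kermxP; rewrite /u row_sub.
have : u *m B = 0.
  apply/trmx_inj; rewrite trmx0; apply/inner_eq0.
  by rewrite /inner trmxK trmx_mul mulmxA -[u *m B *m _]mulmxA uB0 mul0mx linear0.
by move/eqP; rewrite mulmx_free_eq0 // => /eqP.
Qed.

Lemma is_pinv_mul m r n (P : 'M[R]_(m, r)) (Q : 'M[R]_(r, n)) :
  row_free P^T -> row_free Q -> exists X, is_pinv (P *m Q) X.
Proof.
move=> /row_free_gram_unit; rewrite trmxK => uP /row_free_gram_unit uQ.
set V := invmx (Q *m Q^T); set W := invmx (P^T *m P).
have VT : V^T = V by rewrite /V trmx_inv trmx_mul trmxK.
have WT : W^T = W by rewrite /W trmx_inv trmx_mul trmxK.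
pose X := Q^T *m V *m W *m P^T.
have AX : P *m Q *m X = P *m W *m P^T.
  rewrite /X !mulmxA -[P *m Q *m Q^T]mulmxA -[P *m _ *m V]mulmxA.
  by rewrite mulmxV // mulmx1.
have XA : X *m (P *m Q) = Q^T *m V *m Q.
  rewrite /X !mulmxA -[_ *m P^T *m P]mulmxA -[_ *m W *m (P^T *m P)]mulmxA.
  by rewrite mulVmx // mulmx1.
exists X; split.
- rewrite AX !mulmxA -[_ *m P^T *m P]mulmxA -[_ *m W *m (P^T *m P)]mulmxA.
  by rewrite mulVmx // mulmx1.
- rewrite XA /X !mulmxA -[_ *m Q *m Q^T]mulmxA.
  by rewrite -[_ *m V *m (Q *m Q^T)]mulmxA mulVmx // mulmx1.
- by rewrite AX !trmx_mul trmxK WT mulmxA.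
- by rewrite XA !trmx_mul trmxK VT mulmxA.
Qed.

Lemma is_pinv_exists m n (A : 'M[R]_(m, n)) : exists X, is_pinv A X.
Proof.
have := @is_pinv_mul _ _ _ (col_base A) (row_base A).
rewrite mulmx_base; apply; last exact: row_base_free.
by rewrite /row_free mxrank_tr -/(row_full _) col_base_full.
Qed.

Lemma pinvP m n (A : 'M[R]_(m, n)) : is_pinv A (pinv A).
Proof. by have := is_pinv_exists A; move=> /(xgetPex 0). Qed.

End PinvTheory.

Section FactorsTheory.
Context {R : realType} {q : nat} {n k : 'I_q -> nat}.
Implicit Types F U : factors R n k.

Lemma facK F : mkfac (fac F) = F.
Proof.
rewrite /mkfac /fac -[RHS]submxrowK; apply/eq_mxrowP => c.
by rewrite vec_mxK.
Qed.

Lemma mkfacK (M : forall c, 'M[R]_(n c, k c)) c : fac (mkfac M) c = M c.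
Proof. by rewrite /fac /mkfac mxrowK mxvecK. Qed.

Lemma fac_linear c : linear (fun F => fac F c).
Proof. by move=> a F U; apply/matrixP => i j; rewrite /fac !mxE. Qed.

Lemma fac_inj F U : (forall c, fac F c = fac U c) -> F = U.
Proof.
by move=> h; rewrite -[F]facK -[U]facK; apply/eq_mxrowP => c; rewrite h.
Qed.

Lemma inner_mxvec p r (X Y : 'M[R]_(p, r)) :
  inner (mxvec X) (mxvec Y) = inner X Y.
Proof.
rewrite inner_rV innerE pair_bigA /=.
rewrite (reindex _ (curry_mxvec_bij p r)) /=.
by apply: eq_bigr => -[i j] _; rewrite !mxvecE.
Qed.

(* The direct-sum inner product is the dot product of the flattened vectors,
   so that [gradient] and [hessian] are taken with respect to it. *)
Lemma finnerE F U : finner F U = inner F U.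
Proof.
rewrite -[F in RHS]facK -[U in RHS]facK /mkfac /inner mxtrace_mulC tr_mxrow.
rewrite mul_mxrow_mxcol linear_sum /finner; apply: eq_bigr => c _ /=.
by rewrite mxtrace_mulC -[RHS]/(inner _ _) inner_mxvec.
Qed.

End FactorsTheory.

Section ProblemTheory.
Context {R : realType} {q m : nat} {n k : 'I_q -> nat}.
Variables (A : forall c, {linear sym R (n c) -> 'rV[R]_m}).
Implicit Types F U : factors R n k.

Lemma AadjP c (nu : 'rV[R]_m) (X : sym R (n c)) :
  inner (Aadj A c nu) X = inner nu (A c X).
Proof.
suff [Y hY] : exists Y : sym R (n c),
    forall X : sym R (n c), inner Y X = inner nu (A c X).
  have := @xgetPex _ 0 [set V : sym R (n c) | forall Z : sym R (n c),
    inner V Z = inner nu (A c Z)] (ex_intro _ Y hY).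
  exact.
have symE i j : (2^-1 *: (delta_mx i j + delta_mx j i) : 'M[R]_(n c))
    \in sym_pred.
  by rewrite sym_predE linearZ linearD /= !trmx_delta addrC.
pose E i j : sym R (n c) := Sym (symE i j).
pose Y : 'M[R]_(n c) := \matrix_(i, j) inner nu (A c (E i j)).
have EC i j : E i j = E j i by apply: val_inj; rewrite /= addrC.
have sY : Y \in sym_pred.
  by rewrite sym_predE; apply/eqP/matrixP => i j; rewrite !mxE EC.
exists (Sym sY) => Z /=.
have ZE : Z = \sum_i \sum_j symval Z i j *: E i j.
  apply: val_inj; rewrite raddf_sum; under eq_bigr do rewrite raddf_sum.
  rewrite /=.
  have ZT : (symval Z)^T = symval Z by apply/eqP; rewrite -sym_predE; exact: valP.
  transitivity (2^-1 *: (symval Z + (symval Z)^T)).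
    by rewrite ZT scalerDr -scalerDl -[2^-1]mul1r -splitr scale1r.
  rewrite {1 2}[symval Z]matrix_sum_delta linear_sum /= -big_split scaler_sumr.
  apply: eq_bigr => i _ /=; rewrite linear_sum /= -big_split scaler_sumr.
  apply: eq_bigr => j _ /=.
  by rewrite linearZ /= trmx_delta -scalerDr !scalerA mulrC.
rewrite {2}ZE innerE linear_sum inner_sumr; apply: eq_bigr => i _.
rewrite linear_sum inner_sumr; apply: eq_bigr => j _.
by rewrite linearZ innerZr mxE mulrC.
Qed.

Lemma Aadj_linear c : linear (Aadj A c).
Proof.
move=> a u v; set D := LHS; set E := RHS.
have h (X : sym R (n c)) : inner D X = inner E X.
  rewrite AadjP [inner E X]innerC innerDr innerZr !(innerC X) !AadjP.
  by rewrite !(innerC _ (A c X)) innerDr innerZr.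
apply/eqP; rewrite -subr_eq0; apply/eqP/val_inj/inner_eq0.
by rewrite [X in inner X _]/= innerBl h subrr.
Qed.

Lemma Bmap_linear F : linear (Bmap A F).
Proof.
move=> a u v; apply: fac_inj => c; rewrite fac_linear !mkfacK Aadj_linear /=.
by rewrite mulmxDl scalemxAl.
Qed.

Lemma BadjP F U nu : inner (Badj A F U) nu = finner U (Bmap A F nu).
Proof.
pose B := GRing.isLinear.Build _ _ _ _ (Bmap A F) (Bmap_linear F).
pose L : {linear 'rV[R]_m -> factors R n k} := HB.pack (Bmap A F) B.
pose w : 'rV[R]_m := \row_j finner U (L (delta_mx 0 j)).
suff hw x : inner w x = finner U (L x).
  have := @xgetPex _ 0 [set v | forall x, inner v x = finner U (Bmap A F x)]
    (ex_intro _ w hw).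
  exact.
rewrite [x in RHS]row_sum_delta linear_sum finnerE inner_sumr inner_rV.
by apply: eq_bigr => j _; rewrite linearZ innerZr mxE finnerE mulrC.
Qed.

Lemma Badj_linear F : linear (Badj A F).
Proof.
move=> a U V; set D := LHS; set E := RHS.
suff h nu : inner D nu = inner E nu.
  apply/eqP; rewrite -subr_eq0; apply/eqP; apply: inner_eq0.
  by rewrite innerBl h subrr.
rewrite BadjP ![inner E _]innerC innerDr innerZr !(innerC nu) !BadjP.
by rewrite !finnerE !(innerC _ (Bmap _ _ _)) innerDr innerZr.
Qed.

Lemma GramP F (nu : 'rV[R]_m) : nu *m Gram A F = Badj A F (Bmap A F nu).
Proof.
have l : linear (Badj A F \o Bmap A F).
  by move=> a u v; rewrite /= Bmap_linear Badj_linear.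
pose L : {linear 'rV[R]_m -> 'rV[R]_m} :=
  HB.pack (Badj A F \o Bmap A F) (GRing.isLinear.Build _ _ _ _ _ l).
exact: (mul_rV_lin1 L).
Qed.

Lemma Dconstr_linear F : linear (Dconstr A F).
Proof.
move=> a U V; rewrite /Dconstr scaler_sumr -big_split.
apply: eq_bigr => c _ /=.
rewrite -linearZ -linearD; congr (A c _); apply: val_inj => /=.
rewrite fac_linear linearD linearZ /= mulmxDr mulmxDl scalerDr.
by rewrite -scalemxAr -scalemxAl addrACA.
Qed.

Lemma DconstrP F U : U *m lin1_mx (Dconstr A F) = Dconstr A F U.
Proof.
pose L : {linear factors R n k -> 'rV[R]_m} :=
  HB.pack (Dconstr A F) (GRing.isLinear.Build _ _ _ _ _ (Dconstr_linear F)).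
exact: (mul_rV_lin1 L).
Qed.

(* The exact second-order expansion of the constraint; its linear part is
   [Dconstr], which is therefore the differential of [constr]. *)
Lemma constrD b F U :
  constr A b (F + U) =
  constr A b F + Dconstr A F U + \sum_c A c (sym_gram (fac U c)).
Proof.
have e c : sym_gram (fac (F + U) c) =
    sym_gram (fac F c) + sym_cross (fac F c) (fac U c) + sym_gram (fac U c).
  have -> : fac (F + U) c = fac F c + fac U c.
    by rewrite -[F]scale1r fac_linear !scale1r.
  apply: val_inj => /=.
  by rewrite linearD mulmxDl !mulmxDr !addrA.
rewrite /constr /Dconstr.
under [X in X - b = _]eq_bigr do rewrite e !linearD.
by rewrite !big_split /= -!addrA [- b + _]addrC !addrA.
Qed.

End ProblemTheory.

(* Main.v *)
From HB Require Import structures.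
Require Import Defs.
From mathcomp Require Import all_boot all_order all_algebra.
From mathcomp Require Import all_classical all_reals all_analysis.
From mathcomp Require Import ring.

Set Implicit Arguments.
Unset Strict Implicit.
Unset Printing Implicit Defensive.

Import Order.TTheory GRing.Theory Num.Theory.
Import numFieldNormedType.Exports.

Local Open Scope classical_set_scope.
Local Open Scope ring_scope.

(** Write [<.,.>] for the inner products, [D_F] for [Dconstr A F] and [B_F] for
    [Bmap A F].  The adjoint of [D_F] is [2 B_F] ([inner_Dconstr]), so that
    [ker B_F] is the orthogonal complement of the range of [D_F].

    The gradient of the augmented Lagrangian at [F] is
    [2 (CF F - B_F (y - rho c(F)))] ([gradient_auglag]).  At a feasible
    stationary point it vanishes with [c(F) = 0], hence [CF F = B_F y]: the
    penalty disappears and [y] is a multiplier for [F].  The normal equations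
    solved by [muB F] then force [nu = muB F - y] into [ker B_F] ([Bmap_muB]),
    so [S_B F = CF F - B_F (muB F)] vanishes as well.

    For [U] in [ker D_F], the penalty term of the Hessian, [rho B_F (D_F U)],
    is zero ([hessian_auglag]), and positivity of the Hessian reads
    [0 <= <U, CF U - B_U y>].  The wanted inequality has [muB F] in place of
    [y], and the two right-hand sides differ by
    [<U, B_U nu> = <nu, D_U U> / 2].  At a regular point [ker B_F = 0], so
    [nu = 0]; with redundant constraints [nu] may be nonzero, and this is where
    the constant rank hypothesis enters.

    Since [D_(F + t U) = D_F + t D_U], constancy of the rank along the line
    [t |-> F + t U] says that the pencil [D_F + t D_U] does not gain rank for
    small [t].  A pencil which does not gain rank at [t = 0] has no first-order
    block from the kernel of its value at [0] to the corresponding cokernel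
    ([pencil_kernel_cokernel]).  Here [U] lies in the kernel and [nu] in the
    cokernel, so [<nu, D_U U> = 0].  This purely linear argument replaces the
    constant rank theorem, by which one would produce a feasible curve tangent
    to [U] and differentiate the constraint along it twice. *)

(** * Matrix pencils of locally constant rank *)

(** Choose [P], [Q] with [P M Q] the identity of size [rank M].  Bordering with
    [u] and [v], the product of [(P; u)], [M + t E] and [(Q, v)] has [t] as a
    factor of its last column, because [u] and [v] annihilate [M].  Let [K t] be
    what remains once that factor is removed.  For small [t != 0] the rank bound
    forces [\det (K t) = 0]; being polynomial in [t], this determinant vanishes
    at [0] too, where [K 0] is block triangular with diagonal blocks the
    identity and [u E v]. *)
Lemma pencil_kernel_cokernel (R : realType) (p s : nat) (M E : 'M[R]_(p, s))
    (u : 'rV[R]_p) (v : 'cV[R]_s) :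
  (\forall t \near (0 : R), (\rank (M + t *: E)%R <= \rank M)%N) ->
  u *m M = 0 -> M *m v = 0 -> u *m E *m v = 0.
Proof.
move=> rkM uM Mv.
have [P PM] := row_fullP (col_base_full M).
have [Q MQ] := row_freeP (row_base_free M).
set r := \rank M in P PM Q MQ.
have PMQ : P *m M *m Q = 1%:M.
  by rewrite -[M]mulmx_base mulmxA PM mul1mx MQ.
pose K (t : R) : 'M[R]_(r + 1) :=
  block_mx (1%:M + t *: (P *m E *m Q)) (P *m E *m v)
           (t *: (u *m E *m Q)) (u *m E *m v).
have KE t : K t *m block_mx 1%:M 0 0 t%:M =
    col_mx P u *m (M + t *: E) *m row_mx Q v.
  rewrite mul_col_mx mul_col_row mulmx_block !mulmx0 !mulmx1 !add0r !addr0.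
  rewrite !mulmxDr !mulmxDl PMQ -[P *m M *m v]mulmxA Mv uM.
  rewrite !mulmx0 !mul0mx !add0r.
  by rewrite !mul_mx_scalar -!scalemxAr -!scalemxAl.
pose d : {poly R} := \det (block_mx
  (1%:M + 'X *: map_mx polyC (P *m E *m Q)) (map_mx polyC (P *m E *m v))
  ('X *: map_mx polyC (u *m E *m Q)) (map_mx polyC (u *m E *m v))
  : 'M[{poly R}]_(r + 1)).
have dE t : d.[t] = \det (K t).
  rewrite -[d.[t]]/(horner_eval t d) -det_map_mx map_block_mx.
  congr (\det (block_mx _ _ _ _)).
  - apply/matrixP => i j; rewrite !mxE /= /horner_eval !hornerE.
    by case: eqP; rewrite /= !hornerE.
  - by apply/matrixP => i j; rewrite !mxE /= /horner_eval !hornerE.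
  - by apply/matrixP => i j; rewrite !mxE /= /horner_eval !hornerE.
  - by apply/matrixP => i j; rewrite !mxE /= /horner_eval !hornerE.
have d0 : d.[0] = (u *m E *m v) 0 0.
  by rewrite dE /K !scale0r addr0 det_ublock det1 mul1r det_mx11.
have droot (t : R) : t != 0 -> (\rank (M + t *: E)%R <= r)%N -> d.[t] = 0.
  move=> t0 rkt; apply/eqP; apply: contraT => dt0.
  have : K t *m block_mx 1%:M 0 0 t%:M \in unitmx.
    rewrite unitmx_mul !unitmxE det_ublock det1 mul1r det_scalar1 -dE.
    by rewrite !unitfE dt0 t0.
  rewrite KE -row_free_unit => /eqP rkK.
  have : (r + 1 <= r)%N.
    rewrite -[X in (X <= _)%N]rkK; apply: leq_trans rkt.
    exact: leq_trans (mxrankM_maxl _ _) (mxrankM_maxr _ _).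
  by rewrite addn1 ltnn.
suff : d.[0] = 0.
  by rewrite d0 => h; apply/matrixP => i j; rewrite !ord1 h mxE.
apply/eqP; apply: contraT => dn0.
have nearK : \forall t \near (0 : R), d.[t] != 0.
  exact: cvgr_neq0 (@continuous_horner _ d 0) dn0.
have [t [t0 [rkt dt0]]] := filter_ex (filterI (nbhs_dnbhs_neq (0 : R))
  (filterI (nbhs_dnbhs rkM) (nbhs_dnbhs nearK))).
by move: dt0 => /=; rewrite (droot _ t0 rkt) eqxx.
Qed.

(** * Derivatives of polynomial maps *)

(** The augmented Lagrangian is quartic and its gradient cubic, so along any
    line both have an exact expansion of this form, whose linear coefficient is
    the directional derivative. *)
Lemma derive_expansion (R : realType) (V W : normedModType R) (f : V -> W)
    (x v : V) (L r0 r1 r2 : W) :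
  (forall h : R, f (h *: v + x) =
     f x + h *: L + h ^+ 2 *: r0 + h ^+ 3 *: r1 + h ^+ 4 *: r2) ->
  'D_v f x = L.
Proof.
move=> fE; rewrite /derive.
have qE : \forall h \near (0 : R)^', L + h *: r0 + h ^+ 2 *: r1 + h ^+ 3 *: r2 =
    h^-1 *: (f (h *: v + x) - f x).
  near=> h; have h0 : h != 0 by near: h; exact: nbhs_dnbhs_neq.
  rewrite fE [in RHS]addrC !addrA addNr add0r !scalerDr !scalerA.
  rewrite !exprS expr0 !mulr1.
  by rewrite !mulKf // mulVf // scale1r.
have mon n (w : W) : h ^+ n.+1 *: w @[h --> (0 : R)^'] --> (0 : W).
  rewrite [X in _ --> X](_ : 0 = (0 : R) ^+ n.+1 *: w); last first.
    by rewrite expr0n scale0r.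
  apply: cvgZ; last exact: cvg_cst.
  by apply/continuous_withinNx; exact: exprn_continuous.
have lim : (L + h *: r0 + h ^+ 2 *: r1 + h ^+ 3 *: r2) @[h --> (0 : R)^'] --> L.
  rewrite -[X in _ --> X]addr0; apply: cvgD; last exact: mon.
  rewrite -[X in _ --> X]addr0; apply: cvgD; last exact: mon.
  rewrite -[X in _ --> X]addr0; apply: cvgD; last exact: (mon 0%N).
  exact: cvg_cst.
by apply: cvg_lim => //; exact: cvg_trans (near_eq_cvg qE) lim.
Unshelve. all: end_near. Qed.

Lemma linear_rV_differentiable (R : realType) (N : nat) (W : normedModType R)
    (f : 'rV[R]_N -> W) (x : 'rV[R]_N) :
  linear f -> differentiable f x.
Proof.
move=> lf; pose L : {linear 'rV[R]_N -> W} :=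
  HB.pack f (GRing.isLinear.Build _ _ _ _ _ lf).
have -> : f = \sum_(j < N) (fun u : 'rV[R]_N => u 0 j *: f (delta_mx 0 j)).
  apply/funext => u; rewrite fct_sumE -[f u]/(L u).
  rewrite {1}[u]row_sum_delta linear_sum.
  by apply: eq_bigr => j _; rewrite linearZ.
apply: differentiable_sum => j.
by apply: differentiableZl; exact: differentiable_coord.
Qed.

(** In coordinates the map is a finite sum of products of differentiable scalar
    functions times the fixed vectors [B e_j e_l]. *)
Lemma bilinear_rV_differentiable (R : realType) (N M : nat)
    (V W : normedModType R) (B : 'rV[R]_N -> 'rV[R]_M -> W)
    (f : V -> 'rV[R]_N) (g : V -> 'rV[R]_M) (x : V) :
  (forall w, linear (B^~ w)) -> (forall u, linear (B u)) ->
  differentiable f x -> differentiable g x ->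
  differentiable (fun z => B (f z) (g z)) x.
Proof.
move=> lBl lBr df dg.
have -> : (fun z => B (f z) (g z)) = \sum_(j < N) \sum_(l < M)
    (fun z => (f z 0 j * g z 0 l) *: B (delta_mx 0 j) (delta_mx 0 l)).
  apply/funext => z; rewrite fct_sumE.
  pose Bl : {linear 'rV[R]_N -> W} :=
    HB.pack (B^~ (g z)) (GRing.isLinear.Build _ _ _ _ _ (lBl (g z))).
  rewrite -[LHS]/(Bl (f z)) {1}[f z]row_sum_delta linear_sum.
  apply: eq_bigr => j _; rewrite linearZ /= fct_sumE.
  pose Br : {linear 'rV[R]_M -> W} := HB.pack (B (delta_mx 0 j))
    (GRing.isLinear.Build _ _ _ _ _ (lBr (delta_mx 0 j))).
  rewrite -[B _ _]/(Br (g z)) {1}[g z]row_sum_delta linear_sum scaler_sumr.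
  by apply: eq_bigr => l _; rewrite linearZ scalerA.
apply: differentiable_sum => j; apply: differentiable_sum => l.
apply: differentiableZl; apply: differentiableM.
  exact: (differentiable_comp df (differentiable_coord (f x) 0 j)).
exact: (differentiable_comp dg (differentiable_coord (g x) 0 l)).
Qed.

(** * Inner product identities *)

Section InnerAlgebra.
Context {R : realType}.

Lemma innerDl n k (X Y Z : 'M[R]_(n, k)) :
  inner (X + Y) Z = inner X Z + inner Y Z.
Proof. by rewrite !(innerC _ Z) innerDr. Qed.

Lemma innerZl n k a (X Y : 'M[R]_(n, k)) : inner (a *: X) Y = a * inner X Y.
Proof. by rewrite !(innerC _ Y) innerZr. Qed.

Lemma inner_delta N (w : 'rV[R]_N) j : inner w (delta_mx 0 j) = w 0 j.
Proof.
rewrite inner_rV (bigD1 j) //= mxE !eqxx mulr1 big1 ?addr0 // => l lj.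
by rewrite mxE (negPf lj) andbF mulr0.
Qed.

Lemma inner_symr p r (S : sym R p) (X Y : 'M[R]_(p, r)) :
  inner X (S *m Y) = inner (S *m X) Y.
Proof.
have ST : (symval S)^T = symval S by apply/eqP; rewrite -sym_predE; exact: valP.
by rewrite /inner trmx_mul ST mulmxA.
Qed.

Lemma inner_gram p r (S : 'M[R]_p) (X Y : 'M[R]_(p, r)) :
  inner S (X *m Y^T) = inner (S *m Y) X.
Proof.
rewrite innerC [RHS]innerC /inner trmx_mul trmxK -mulmxA.
by rewrite mxtrace_mulC mulmxA.
Qed.

Lemma inner_gramC p r (S : sym R p) (X Y : 'M[R]_(p, r)) :
  inner S (X *m Y^T) = inner S (Y *m X^T).
Proof. by rewrite !inner_gram [RHS]innerC inner_symr. Qed.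

End InnerAlgebra.

(** * Gradient and Hessian of the augmented Lagrangian *)

Section AugmentedLagrangian.
Context {R : realType} {q m : nat} {n k : 'I_q -> nat}.
Variables (C : forall c, sym R (n c)).
Variables (A : forall c, {linear sym R (n c) -> 'rV[R]_m}) (b : 'rV[R]_m).
Implicit Types (F U V : factors R n k) (nu : 'rV[R]_m).

Lemma facD F U c : fac (F + U) c = fac F c + fac U c.
Proof. by rewrite -[F]scale1r fac_linear !scale1r. Qed.

Lemma facZ a F c : fac (a *: F) c = a *: fac F c.
Proof. by apply/matrixP => i j; rewrite /fac !mxE. Qed.

Lemma CF_linear : linear (@CF R q n k C).
Proof.
move=> a F U; apply: fac_inj => c.
by rewrite fac_linear !mkfacK facD facZ mulmxDr scalemxAr.
Qed.

Lemma Bmap_linearl nu : linear (fun F => Bmap A F nu).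
Proof.
move=> a F U; apply: fac_inj => c.
by rewrite fac_linear !mkfacK facD facZ mulmxDr scalemxAr.
Qed.

Lemma DconstrC F U : Dconstr A F U = Dconstr A U F.
Proof.
rewrite /Dconstr; apply: eq_bigr => c _; congr (A c _).
by apply: val_inj => /=; rewrite addrC.
Qed.

Lemma Dconstr_linearl U : linear (fun F => Dconstr A F U).
Proof. by move=> a F V; rewrite ![Dconstr A _ U]DconstrC Dconstr_linear. Qed.

Lemma sum_gramE F : \sum_c A c (sym_gram (fac F c)) = 2^-1 *: Dconstr A F F.
Proof.
rewrite /Dconstr scaler_sumr; apply: eq_bigr => c _; rewrite -linearZ.
congr (A c _); apply: val_inj => /=.
by rewrite scalerDr -scalerDl -[2^-1]mul1r -splitr scale1r.
Qed.

(** Twice [Bmap A F] is the adjoint of [Dconstr A F].  The factor [2] comes from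
    the two halves of the symmetric cross term, which pair equally with the
    symmetric matrix [Aadj A c nu]. *)
Lemma inner_Dconstr nu F U :
  inner nu (Dconstr A F U) = 2 * finner (Bmap A F nu) U.
Proof.
rewrite inner_sumr /finner mulr_sumr; apply: eq_bigr => c _.
by rewrite -AadjP /= innerDr inner_gramC inner_gram mkfacK mulr_natl mulr2n.
Qed.

Lemma objectiveE F : objective C F = finner (CF C F) F.
Proof. by apply: eq_bigr => c _; rewrite inner_gram mkfacK. Qed.

Lemma finner_CFC F U : finner (CF C F) U = finner (CF C U) F.
Proof. by apply: eq_bigr => c _; rewrite !mkfacK -inner_symr innerC. Qed.

Variables (rho : R) (y : 'rV[R]_m).

Definition auglag_grad F : factors R n k :=
  2 *: (CF C F - Bmap A F (y - rho *: constr A b F)).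

HB.instance Definition _ := GRing.isLinear.Build R (factors R n k)
  (factors R n k) _ (CF C) CF_linear.
HB.instance Definition _ F := GRing.isLinear.Build R 'rV[R]_m
  (factors R n k) _ (Bmap A F) (Bmap_linear A F).
HB.instance Definition _ F := GRing.isLinear.Build R (factors R n k)
  'rV[R]_m _ (Dconstr A F) (Dconstr_linear A F).

Lemma BmapDl F U nu : Bmap A (F + U) nu = Bmap A F nu + Bmap A U nu.
Proof. by have := Bmap_linearl nu 1 F U; rewrite !scale1r. Qed.

Lemma BmapZl a F nu : Bmap A (a *: F) nu = a *: Bmap A F nu.
Proof. by apply: fac_inj => c; rewrite facZ !mkfacK facZ scalemxAr. Qed.

Lemma BmapDr F nu mu : Bmap A F (nu + mu) = Bmap A F nu + Bmap A F mu.
Proof. exact: linearD. Qed.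

Lemma BmapZr a F nu : Bmap A F (a *: nu) = a *: Bmap A F nu.
Proof. exact: linearZ. Qed.

Lemma BmapBr F nu mu : Bmap A F (nu - mu) = Bmap A F nu - Bmap A F mu.
Proof. exact: linearB. Qed.

Lemma constr_line F V h : constr A b (h *: V + F) =
  constr A b F + h *: Dconstr A F V + h ^+ 2 *: (2^-1 *: Dconstr A V V).
Proof.
rewrite addrC constrD sum_gramE; congr (_ + _ + _); first by rewrite linearZ.
have e : Dconstr A (h *: V) V = h *: Dconstr A V V.
  by rewrite (DconstrC (h *: V)) linearZ.
rewrite [X in _ *: X](_ : _ = h ^+ 2 *: Dconstr A V V); last first.
  by rewrite linearZ /= e scalerA expr2.
by rewrite !scalerA mulrC.
Qed.

(** In the expansion at [h *: V + F], the coefficients of [h ^+ 2], [h ^+ 3] and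
    [h ^+ 4] collect the curvature of the objective and what the constraint
    value [c + h *: D + h ^+ 2 *: Q] contributes to the multiplier and penalty
    terms beyond first order. *)
Lemma derive_auglag F V :
  'D_V (auglag C A b rho y) F = finner (auglag_grad F) V.
Proof.
set c := constr A b F; set D := Dconstr A F V.
set Q := 2^-1 *: Dconstr A V V.
apply: (@derive_expansion _ _ _ _ _ _ _
  (finner (CF C V) V - inner y Q + rho / 2 * (inner D D + 2 * inner c Q))
  (rho * inner D Q) (rho / 2 * inner Q Q)) => h.
rewrite /auglag constr_line -/c -/D -/Q !objectiveE.
have -> : finner (auglag_grad F) V =
    2 * finner (CF C F) V - inner y D + rho * inner c D.
  have e : Bmap A F (y - rho *: c) = Bmap A F y - rho *: Bmap A F c.
    by rewrite BmapBr BmapZr.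
  rewrite !inner_Dconstr /auglag_grad -/c e !finnerE innerZl !innerBl innerZl.
  by ring.
have -> : finner (CF C (h *: V + F)) (h *: V + F) =
    finner (CF C F) F + h * (2 * finner (CF C F) V)
    + h ^+ 2 * finner (CF C V) V.
  rewrite linearD linearZ /= !finnerE !(innerDl, innerDr, innerZl, innerZr).
  by rewrite -!finnerE (finner_CFC V F); ring.
(* [c], [D] and [Q] are made opaque: the bilinear expansion below must not
   reach the sums and differences that they stand for. *)
move: c D Q => c D Q; rewrite !(innerDl, innerDr, innerZl, innerZr).
rewrite (innerC D c) (innerC Q c) (innerC Q D) /GRing.scale /=.
by field.
Qed.

Lemma gradient_auglag : gradient (auglag C A b rho y) = auglag_grad.
Proof.
apply/funext => F; apply/rowP => j.
by rewrite mxE derive_auglag finnerE inner_delta.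
Qed.

(** The Hessian is the Jacobian of the gradient, i.e. its Frechet differential;
    only once that exists is it determined by directional derivatives. *)
Lemma differentiable_auglag_grad F : differentiable auglag_grad F.
Proof.
apply: differentiableZ; apply: differentiableB.
  by apply: linear_rV_differentiable; exact: CF_linear.
apply: (@bilinear_rV_differentiable _ _ _ _ _ (@Bmap R q m n k A) id).
- exact: Bmap_linearl.
- exact: Bmap_linear.
- by apply: linear_rV_differentiable.
apply: differentiableB; first exact: differentiable_cst.
apply: differentiableZ; apply: differentiableB; last exact: differentiable_cst.
have -> : (fun G : factors R n k => \sum_c A c (sym_gram (fac G c))) =
    2^-1 *: (fun G : factors R n k => Dconstr A G G).
  by apply/funext => G; rewrite sum_gramE.
apply: differentiableZ.
apply: (@bilinear_rV_differentiable _ _ _ _ _ (@Dconstr R q m n k A) id id).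
- exact: Dconstr_linearl.
- exact: Dconstr_linear.
- by apply: linear_rV_differentiable.
- by apply: linear_rV_differentiable.
Qed.

Lemma hessian_auglag F U : U *m hessian (auglag C A b rho y) F =
  2 *: (CF C U - Bmap A U (y - rho *: constr A b F)
        + rho *: Bmap A F (Dconstr A F U)).
Proof.
rewrite /hessian gradient_auglag -deriveEjacobian; last first.
  exact: differentiable_auglag_grad.
set D := Dconstr A F U; set Q := 2^-1 *: Dconstr A U U.
apply: (@derive_expansion _ _ _ _ _ _ _
  ((2 * rho) *: (Bmap A U D + Bmap A F Q)) ((2 * rho) *: Bmap A U Q) 0) => h.
rewrite /auglag_grad constr_line -/D -/Q scaler0 addr0.
have CFh : CF C (h *: U + F) = h *: CF C U + CF C F by rewrite CF_linear.
have Bh (G : factors R n k) :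
    Bmap A G (y - rho *: (constr A b F + h *: D + h ^+ 2 *: Q)) =
    Bmap A G y - rho *: (Bmap A G (constr A b F) + h *: Bmap A G D
                         + h ^+ 2 *: Bmap A G Q).
  by rewrite BmapBr BmapZr !BmapDr !BmapZr.
have B0 (G : factors R n k) : Bmap A G (y - rho *: constr A b F) =
    Bmap A G y - rho *: Bmap A G (constr A b F) by rewrite BmapBr BmapZr.
rewrite CFh Bh !B0 !BmapDl !BmapZl.
(* What remains is a formal identity between these vectors; naming them keeps
   the passage to entries from unfolding them. *)
move: (CF C U) (CF C F) (Bmap A U y) (Bmap A F y) (Bmap A U D) (Bmap A F D).
move: (Bmap A U Q) (Bmap A F Q).
move: (Bmap A U (constr A b F)) (Bmap A F (constr A b F)).
move=> x1 x2 x3 x4 x5 x6 x7 x8 x9 x10; apply/rowP => j; rewrite !mxE; ring.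
Qed.

End AugmentedLagrangian.

(** * Multipliers at a stationary point *)

Section Multipliers.
Context {R : realType} {q m : nat} {n k : 'I_q -> nat}.
Variables (C : forall c, sym R (n c)).
Variables (A : forall c, {linear sym R (n c) -> 'rV[R]_m}).
Implicit Types (F U V : factors R n k) (y nu : 'rV[R]_m).

Lemma SB_blocks F U c :
  SB C A F c *m fac U c = fac (CF C U - Bmap A U (muB C A F)) c.
Proof.
rewrite -scaleN1r facD facZ !mkfacK scaleN1r.
by rewrite -[symval (SB _ _ _ _)]/(symval (C c) - symval (Aadj A c _)) mulmxBl.
Qed.

(** If [CF F] lies in the range of [B_F], the least-squares multiplier [muB F]
    reproduces it exactly: [z = muB F - y] satisfies [G z = 0] for the Gram
    operator [G = B_F^* B_F], and [<G z, z>] is the squared norm of [B_F z].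
    The multipliers themselves may differ, as [B_F] need not be injective. *)
Lemma Bmap_muB F y : CF C F = Bmap A F y -> Bmap A F (muB C A F) = Bmap A F y.
Proof.
move=> CFy; apply/eqP; rewrite -subr_eq0 -BmapBr; apply/eqP.
set z := muB C A F - y.
have zG : z *m Gram A F = 0.
  rewrite /z mulmxBl /muB CFy -GramP -!mulmxA (mulmxA (Gram A F)).
  by case: (pinvP (Gram A F)) => -> *; rewrite subrr.
apply: inner_eq0; rewrite -finnerE -BadjP -GramP zG.
by rewrite innerC inner0r.
Qed.

(** Second-order consequence of the constant rank condition: the curvature
    [D_U U] of the constraint in a direction [U] of [ker D_F] stays in the range
    of [D_F]. *)
Lemma inner_Dconstr_constant_rank F U nu (O : set (factors R n k)) (r : nat) :
  open O -> O F ->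
  (forall G, O G -> \rank (lin1_mx (Dconstr A G)) = r) ->
  Dconstr A F U = 0 -> Bmap A F nu = 0 -> inner nu (Dconstr A U U) = 0.
Proof.
move=> oO OF rkO DU Bnu.
have DtrV G V mu : V *m lin1_mx (Dconstr A G) *m mu^T =
    (inner mu (Dconstr A G V))%:M.
  rewrite DconstrP [LHS]mx11_scalar; congr (_%:M).
  by rewrite innerC inner_rV !mxE; apply: eq_bigr => j _; rewrite mxE.
have : U *m lin1_mx (Dconstr A U) *m nu^T = 0.
  apply: (@pencil_kernel_cokernel _ _ _ (lin1_mx (Dconstr A F))).
  - have near_O : \forall t \near (0 : R), O (F + t *: U).
      have : F + t *: U @[t --> (0 : R)] --> F + 0 *: U.
        apply: cvgD; first exact: cvg_cst.
        by apply: cvgZ; [exact: cvg_id|exact: cvg_cst].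
      rewrite scale0r addr0; apply; exact: open_nbhs_nbhs.
    apply: filterS near_O => t OFt.
    (* [Dconstr A G] is linear in [G], so it maps the line to a pencil. *)
    have -> : (lin1_mx (Dconstr A F) + t *: lin1_mx (Dconstr A U))%R =
        lin1_mx (Dconstr A (F + t *: U)).
      apply/row_matrixP => i; rewrite !rowE mulmxDr -scalemxAr !DconstrP.
      by rewrite !(DconstrC _ _ (delta_mx 0 i)) linearD linearZ.
    by rewrite (rkO _ OFt) (rkO _ OF).
  - by rewrite DconstrP.
  - apply/row_matrixP => i; rewrite rowE mulmxA DtrV inner_Dconstr Bnu row0.
    by rewrite finnerE innerC inner0r mulr0 raddf0.
by rewrite DtrV => /matrixP /(_ 0 0); rewrite !mxE eqxx.
Qed.

End Multipliers.

Theorem proposition1 (R : realType) (q m : nat) (n k : 'I_q -> nat)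
    (q_gt0 : (0 < q)%N) (m_gt0 : (0 < m)%N)
    (n_gt0 : forall c, (0 < n c)%N) (k_gt0 : forall c, (0 < k c)%N)
    (b : 'rV[R]_m) (C : forall c, sym R (n c))
    (A : forall c, {linear sym R (n c) -> 'rV[R]_m})
    (const_rank : feasible (k := k) A b !=set0 ->
       exists2 U : set (factors R n k), open U /\ feasible A b `<=` U &
         exists r : nat, forall F, U F -> \rank (lin1_mx (Dconstr A F)) = r)
    (y : 'rV[R]_m) (rho : R) (rho_gt0 : 0 < rho) (F : factors R n k)
    (F_sosp : feasible_sosp C A b rho y F) :
  (forall c, SB C A F c *m fac F c = 0) /\
  (forall U : factors R n k, Dconstr A F U = 0 ->
     0 <= \sum_c inner (fac U c) (SB C A F c *m fac U c)).
Proof.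
case: F_sosp => feasF gradF hessF.
have CFy : CF C F = Bmap A F y.
  apply/eqP; rewrite -subr_eq0; move/eqP: gradF.
  rewrite gradient_auglag /auglag_grad feasF scaler0 subr0.
  by rewrite scaler_eq0 pnatr_eq0.
have muBy := Bmap_muB CFy.
split=> [c|U DU].
  by rewrite SB_blocks muBy CFy subrr -(scale0r 0) facZ scale0r.
have [N [oN feasN] [r rkO]] := const_rank (ex_intro _ F feasF).
under eq_bigr do rewrite SB_blocks.
rewrite -/(finner U _).
(* Passing from the multiplier [y] to [muB F] costs nothing on [ker D_F]. *)
have BU0 : finner U (Bmap A U (muB C A F - y)) = 0.
  have nu0 : Bmap A F (muB C A F - y) = 0 by rewrite BmapBr muBy subrr.
  have := inner_Dconstr_constant_rank oN (feasN _ feasF) rkO DU nu0.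
  rewrite inner_Dconstr finnerE innerC -finnerE => /eqP.
  by rewrite mulf_eq0 pnatr_eq0 => /eqP.
have -> : CF C U - Bmap A U (muB C A F) =
    CF C U - Bmap A U y - Bmap A U (muB C A F - y).
  by rewrite BmapBr opprB addrA subrK.
rewrite finnerE innerC innerBl !(innerC _ U) -!finnerE BU0 subr0.
have := hessF U; rewrite hessian_auglag feasF DU scaler0 subr0.
by rewrite linear0 scaler0 addr0 finnerE innerZr -finnerE pmulr_rge0.
Qed.
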